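(* Let $\mathcal D=(D,\min,+_D,\infty_D,0_D)$ be a commutative, totally ordered, idempotent dioid and $\mathcal A=(A,+_A,\times_A,0_A,1_A)$ a commutative semiring. Then the delta product $\mathcal D\Delta\mathcal A$ is a commutative semiring.
   Context: A semiring $(A,+,\times,0,1)$: $(A,+,0)$ is a commutative monoid, $(A,\times,1)$ a monoid, $\times$ distributes over $+$, $0$ is absorbing for $\times$, and $0\ne1$; commutative if $\times$ is commutative. A dioid is a semiring $(D,\min,+_D,\infty_D,0_D)$ (here $\min$ is the name of the additive operation and $+_D$ the multiplicative one) for which the relation $d_1\le_D d_2 \iff \exists c\in D,\ \min(d_2,c)=d_1$ is a partial order; it is idempotent if $\min(d,d)=d$ for all $d$ and totally ordered if $\le_D$ is total. An element $d\in D\setminus\{\infty_D\}$ is multiplicatively regular if $d+_Db=d+_Dc$ implies $b=c$; $reg(\mathcal D)$ denotes the set of such elements. For $d\in D,a\in A$ set $d\Delta a=(d,a)$ if $d\in reg(\mathcal D)$ and $d\Delta a=(d,0_A)$ otherwise. The delta product is $\mathcal D\Delta\mathcal A=(D\Delta A,\oplus,\otimes,(\infty_D,0_A),(0_D,1_A))$ where $D\Delta A=\{(d,a)\in D\times A: d\in reg(\mathcal D)\text{ or }a=0_A\}$, $(d_1,a_1)\oplus(d_2,a_2)=(\min(d_1,d_2),a)$ with $a=a_1$ if $d_1<_Dd_2$, $a=a_2$ if $d_2<_Dd_1$, $a=a_1+_Aa_2$ if $d_1=d_2$; and $(d_1,a_1)\otimes(d_2,a_2)=(d_1+_Dd_2,a_1\times_Aa_2)$.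 *)

(* Defs.v *)
From mathcomp Require Import all_boot all_order all_algebra.
From mathcomp Require Import boolp.

Set Implicit Arguments.
Unset Strict Implicit.
Unset Printing Implicit Defensive.

Import GRing.Theory.

Local Open Scope ring_scope.

(* A dioid (D, min, +_D, oo_D, 0_D) is a mathcomp semiring D, whose ring       *)
(* operations read as follows:                                                *)
(*   min is x + y,   +_D is x * y,   oo_D is 0,   0_D is 1.                   *)

Definition dle (D : nzSemiRingType) : rel D :=
  fun d1 d2 => `[< exists c : D, d2 + c = d1 >].

Definition dlt (D : nzSemiRingType) : rel D :=
  fun d1 d2 => (d1 != d2) && dle d1 d2.

Definition dioid (D : nzSemiRingType) : Prop :=
  [/\ reflexive (@dle D), antisymmetric (@dle D) & transitive (@dle D)].

Definition idempotent_dioid (D : nzSemiRingType) : Prop :=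
  dioid D /\ forall d : D, d + d = d.

Definition totally_ordered_dioid (D : nzSemiRingType) : Prop :=
  dioid D /\ total (@dle D).

Definition mul_regular (D : nzSemiRingType) : pred D :=
  fun d => `[< d <> 0 /\ GRing.lreg d >].

Definition in_delta (D A : nzSemiRingType) : pred (D * A) :=
  fun p => mul_regular p.1 || (p.2 == 0).

Definition delta (D A : nzSemiRingType) : Type := {p : D * A | in_delta p}.

(* The operations are given on all pairs; that D Delta A is closed under them *)
(* is not built in. When dle is total, the last branch of delta_add is the    *)
(* case p.1 = q.1.                                                            *)
Definition delta_add (D A : nzSemiRingType) (p q : D * A) : D * A :=
  (p.1 + q.1,
   if dlt p.1 q.1 then p.2 else if dlt q.1 p.1 then q.2 else p.2 + q.2).

Definition delta_mul (D A : nzSemiRingType) (p q : D * A) : D * A :=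
  (p.1 * q.1, p.2 * q.2).

(* The mathcomp commutative semirings (with 0 != 1) are the records           *)
(* comNzSemiRingType; a class on the type delta D A is a commutative semiring *)
(* structure with that carrier. The equations fix its operations and          *)
(* constants, and hence the closure of the carrier under them.                *)
Definition delta_is_comm_semiring (D A : nzSemiRingType) : Prop :=
  exists c : GRing.ComNzSemiRing (delta D A),
    let S : comNzSemiRingType := GRing.ComNzSemiRing.Pack c in
    [/\ forall x y : delta D A,
          sval (@GRing.add S x y) = delta_add (sval x) (sval y),
        forall x y : delta D A,
          sval (@GRing.mul S x y) = delta_mul (sval x) (sval y),
        sval (@GRing.zero S) = (0, 0) &
        sval (@GRing.one S) = (1, 1)].

(* Main.v *)
Require Import Defs.
From HB Require Import structures.
From mathcomp Require Import all_boot all_order all_algebra.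
From mathcomp Require Import boolp.

(** In a totally ordered idempotent dioid the second component of the delta
    sum of [(d1, a1)] and [(d2, a2)] is the sum of those [ai] whose [di] attains
    the minimum [m = d1 + d2], that is [a1 *+ (m == d1) + a2 *+ (m == d2)].
    Associativity then says that [d1] attains a triple minimum iff it attains
    it within the first two terms and these attain it together. Distributivity
    says that multiplication by a regular [d] preserves where the minimum is
    attained; a non-regular [d] carries the coefficient [0], which makes both
    sides vanish. *)

Set Implicit Arguments.
Unset Strict Implicit.
Unset Printing Implicit Defensive.

Import GRing.Theory.

Local Open Scope ring_scope.

(** If [y + c = x], adding another [y] to [x] changes nothing by idempotence; conversely [x] itself
    serves as the witness [c]. *)
Lemma dle_addE (D : nzSemiRingType) (x y : D) :
  idempotent_dioid D -> dle x y = (x + y == x).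
Proof.
case=> _ idem; apply/asboolP/eqP => [[c <-]|<-]; last by exists x; rewrite addrC.
by rewrite addrAC idem.
Qed.

(** When [x] equals the triple sum it already absorbs [y], by idempotence, so the intermediate sum
    [x + y] collapses to [x] as well. *)
Lemma add_eql_sub (D : nzSemiRingType) (x y z : D) :
  idempotent_dioid D ->
  (x + y + z == x + y) && (x + y == x) = (x + y + z == x).
Proof.
case=> _ idem; apply/andP/eqP => [[/eqP-> /eqP//]|xyzE].
have xyE : x + y = x by rewrite -{1}xyzE addrAC -(addrA x) idem xyzE.
by rewrite xyzE xyE eqxx.
Qed.

Lemma mul_regular1 (D : nzSemiRingType) : mul_regular (1 : D).
Proof. by apply/asboolP; split; [exact/eqP/oner_neq0 | exact: lreg1]. Qed.

Lemma mul_regularM (D : nzSemiRingType) (x y : D) :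
  mul_regular x -> mul_regular y -> mul_regular (x * y).
Proof.
move=> /asboolP[_ regx] /asboolP[y0 regy]; apply/asboolP; split.
  (* Cancelling [x] in [x * y = x * 0] would give [y = 0]. *)
  by move=> xy0; apply/y0/regx; rewrite xy0 mulr0.
exact: lregM.
Qed.

Lemma in_delta_zero (D A : nzSemiRingType) : in_delta ((0, 0) : D * A).
Proof. by rewrite /in_delta eqxx orbT. Qed.

Lemma in_delta_one (D A : nzSemiRingType) : in_delta ((1, 1) : D * A).
Proof. by rewrite /in_delta mul_regular1. Qed.

Lemma in_delta_mul (D A : nzSemiRingType) (p q : D * A) :
  in_delta p -> in_delta q -> in_delta (delta_mul p q).
Proof.
rewrite /in_delta /= => /orP[regp|/eqP->]; last by rewrite mul0r eqxx orbT.
case/orP=> [regq|/eqP->]; last by rewrite mulr0 eqxx orbT.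
by rewrite mul_regularM.
Qed.

Lemma delta_addE (D A : nzSemiRingType) (p q : D * A) :
  totally_ordered_dioid D -> idempotent_dioid D ->
  delta_add p q =
    (p.1 + q.1,
     p.2 *+ (p.1 + q.1 == p.1) + q.2 *+ (p.1 + q.1 == q.1)).
Proof.
move=> [_ tot] hDidem; have [_ idem] := hDidem.
have:= tot p.1 q.1; rewrite /delta_add /dlt !dle_addE // (addrC q.1).
have [->|neq] := eqVneq p.1 q.1; first by rewrite !idem eqxx.
have [->|_ /= ->] := eqVneq (p.1 + q.1) p.1.
  by rewrite (negPf neq) addr0.
by rewrite add0r.
Qed.

(** If the minimum is not regular, every argument attaining it has coefficient [0], so the
    coefficient of the sum vanishes. *)
Lemma in_delta_add (D A : nzSemiRingType) (p q : D * A) :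
  totally_ordered_dioid D -> idempotent_dioid D ->
  in_delta p -> in_delta q -> in_delta (delta_add p q).
Proof.
move=> hDtot hDidem; rewrite delta_addE // /in_delta /= => hp hq.
have [//|/= nreg] := boolP (mul_regular _).
apply/eqP; have vanish (r : D * A) : mul_regular r.1 || (r.2 == 0) ->
    r.2 *+ (p.1 + q.1 == r.1) = 0.
  have [<-|//] := eqVneq (p.1 + q.1) r.1.
  by rewrite (negPf nreg) => /eqP->.
by rewrite !vanish // addr0.
Qed.

Lemma delta_addC (D A : nzSemiRingType) (p q : D * A) :
  totally_ordered_dioid D -> idempotent_dioid D ->
  delta_add p q = delta_add q p.
Proof.
by move=> hDtot hDidem; rewrite !delta_addE // (addrC p.1) (addrC (p.2 *+ _)).
Qed.

Lemma delta_addA (D A : nzSemiRingType) (p q r : D * A) :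
  totally_ordered_dioid D -> idempotent_dioid D ->
  delta_add p (delta_add q r) = delta_add (delta_add p q) r.
Proof.
move=> hDtot hDidem; rewrite !delta_addE //=.
(* Nested multiplicities become conjunctions of indicators, so each of the three coefficients can be
   compared separately. *)
rewrite !mulrnDl -!mulrnA !mulnb addrA.
congr (_, _); rewrite [LHS]addrA.
congr (_ *+ nat_of_bool _ + _ *+ nat_of_bool _ + _ *+ nat_of_bool _).
- by rewrite [RHS]andbC add_eql_sub //.
(* Both conditions say that [q.1] attains the triple minimum; the sums are permuted to bring [q.1]
   to the front, as [add_eql_sub] requires. *)
- rewrite [RHS]andbC (addrC p.1 q.1) add_eql_sub // andbC.
  by rewrite -(addrA q.1) (addrC p.1 r.1) (addrA q.1) add_eql_sub.
- by rewrite -addrA addrC (addrC q.1) andbC add_eql_sub.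
Qed.

Lemma delta_add0 (D A : nzSemiRingType) (p : D * A) :
  totally_ordered_dioid D -> idempotent_dioid D ->
  delta_add (0, 0) p = p.
Proof.
move=> hDtot hDidem; rewrite delta_addE //= add0r eqxx mul0rn add0r.
by case: p.
Qed.

(** Membership of [r] matters: if [r.1] identifies two distinct elements [p.1] and [q.1], the right
    side can pick up a coefficient that the left side drops. *)
Lemma delta_mulDl (D A : comNzSemiRingType) (p q r : D * A) :
  totally_ordered_dioid D -> idempotent_dioid D -> in_delta r ->
  delta_mul (delta_add p q) r = delta_add (delta_mul p r) (delta_mul q r).
Proof.
move=> hDtot hDidem; rewrite !delta_addE // /delta_mul /in_delta /= mulrDl.
case/orP=> [/asboolP[_ regr]|/eqP->]; last by rewrite !mulr0 !mul0rn addr0.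
(* Regularity is left cancellation; commutativity of [D] turns it into cancellation on the right. *)
have regE x y : (x * r.1 == y * r.1) = (x == y).
  by apply/eqP/eqP => [|->//]; rewrite !(mulrC _ r.1) => /regr.
by rewrite -!(mulrDl _ _ r.1) !regE (mulrDl _ _ r.2) !mulrnAl.
Qed.

(* An alias of [delta D A] carrying the hypotheses, so that canonical
   structures depending on them can be attached to it. *)
Definition delta_semiring (D A : comNzSemiRingType)
    (hDtot : totally_ordered_dioid D) (hDidem : idempotent_dioid D) : Type :=
  delta D A.

HB.instance Definition _ (D A : comNzSemiRingType)
    (hDtot : totally_ordered_dioid D) (hDidem : idempotent_dioid D) :=
  Choice.copy (delta_semiring A hDtot hDidem) {p : D * A | in_delta p}.

Definition dsr_add (D A : comNzSemiRingType) (hDtot : totally_ordered_dioid D)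
    (hDidem : idempotent_dioid D) (x y : delta_semiring A hDtot hDidem) :
    delta_semiring A hDtot hDidem :=
  exist (fun p : D * A => in_delta p) _
    (in_delta_add hDtot hDidem (svalP x) (svalP y)).

Definition dsr_mul (D A : comNzSemiRingType) (hDtot : totally_ordered_dioid D)
    (hDidem : idempotent_dioid D) (x y : delta_semiring A hDtot hDidem) :
    delta_semiring A hDtot hDidem :=
  exist (fun p : D * A => in_delta p) _
    (in_delta_mul (svalP x) (svalP y)).

Definition dsr_zero (D A : comNzSemiRingType) (hDtot : totally_ordered_dioid D)
    (hDidem : idempotent_dioid D) : delta_semiring A hDtot hDidem :=
  exist (fun p : D * A => in_delta p) _
    (in_delta_zero D A).

Definition dsr_one (D A : comNzSemiRingType) (hDtot : totally_ordered_dioid D)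
    (hDidem : idempotent_dioid D) : delta_semiring A hDtot hDidem :=
  exist (fun p : D * A => in_delta p) _
    (in_delta_one D A).

Lemma dsr_addA (D A : comNzSemiRingType) (hDtot : totally_ordered_dioid D)
    (hDidem : idempotent_dioid D) : associative (@dsr_add D A hDtot hDidem).
Proof. by move=> x y z; apply/val_inj/delta_addA. Qed.

Lemma dsr_addC (D A : comNzSemiRingType) (hDtot : totally_ordered_dioid D)
    (hDidem : idempotent_dioid D) : commutative (@dsr_add D A hDtot hDidem).
Proof. by move=> x y; apply/val_inj/delta_addC. Qed.

Lemma dsr_add0 (D A : comNzSemiRingType) (hDtot : totally_ordered_dioid D)
    (hDidem : idempotent_dioid D) :
  left_id (dsr_zero A hDtot hDidem) (@dsr_add D A hDtot hDidem).
Proof. by move=> x; apply/val_inj/delta_add0. Qed.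

HB.instance Definition _ (D A : comNzSemiRingType)
    (hDtot : totally_ordered_dioid D) (hDidem : idempotent_dioid D) :=
  GRing.isNmodule.Build (delta_semiring A hDtot hDidem)
    (@dsr_addA D A hDtot hDidem) (@dsr_addC D A hDtot hDidem)
    (@dsr_add0 D A hDtot hDidem).

Lemma dsr_mulA (D A : comNzSemiRingType) (hDtot : totally_ordered_dioid D)
    (hDidem : idempotent_dioid D) : associative (@dsr_mul D A hDtot hDidem).
Proof. by move=> x y z; apply/val_inj; rewrite /= /delta_mul /= !mulrA. Qed.

Lemma dsr_mulC (D A : comNzSemiRingType) (hDtot : totally_ordered_dioid D)
    (hDidem : idempotent_dioid D) : commutative (@dsr_mul D A hDtot hDidem).
Proof.
by move=> x y; apply/val_inj; congr (_, _); rewrite /= mulrC.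
Qed.

Lemma dsr_mul1 (D A : comNzSemiRingType) (hDtot : totally_ordered_dioid D)
    (hDidem : idempotent_dioid D) :
  left_id (dsr_one A hDtot hDidem) (@dsr_mul D A hDtot hDidem).
Proof.
by move=> x; apply/val_inj; rewrite /= /delta_mul !mul1r -surjective_pairing.
Qed.

Lemma dsr_mulDl (D A : comNzSemiRingType) (hDtot : totally_ordered_dioid D)
    (hDidem : idempotent_dioid D) :
  left_distributive (@dsr_mul D A hDtot hDidem) (@dsr_add D A hDtot hDidem).
Proof.
by move=> x y z; apply/val_inj/delta_mulDl => //; exact: (svalP z).
Qed.

Lemma dsr_mul0 (D A : comNzSemiRingType) (hDtot : totally_ordered_dioid D)
    (hDidem : idempotent_dioid D) :
  left_zero (dsr_zero A hDtot hDidem) (@dsr_mul D A hDtot hDidem).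
Proof. by move=> x; apply/val_inj; rewrite /= /delta_mul !mul0r. Qed.

Lemma dsr_one_neq0 (D A : comNzSemiRingType) (hDtot : totally_ordered_dioid D)
    (hDidem : idempotent_dioid D) :
  dsr_one A hDtot hDidem != dsr_zero A hDtot hDidem.
(* The first components already differ, since [1 != 0] in [D]. *)
Proof. by apply/eqP => -[/eqP]; rewrite oner_eq0. Qed.

HB.instance Definition _ (D A : comNzSemiRingType)
    (hDtot : totally_ordered_dioid D) (hDidem : idempotent_dioid D) :=
  GRing.Nmodule_isComNzSemiRing.Build (delta_semiring A hDtot hDidem)
    (@dsr_mulA D A hDtot hDidem) (@dsr_mulC D A hDtot hDidem)
    (@dsr_mul1 D A hDtot hDidem) (@dsr_mulDl D A hDtot hDidem)
    (@dsr_mul0 D A hDtot hDidem) (@dsr_one_neq0 D A hDtot hDidem).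

Theorem theorem3 (D A : comNzSemiRingType)
    (hDtot : totally_ordered_dioid D) (hDidem : idempotent_dioid D) :
  delta_is_comm_semiring D A.
Proof.
(* The alias unfolds to [delta D A], and the four equations hold by computation. *)
by exists (GRing.ComNzSemiRing.on (delta_semiring A hDtot hDidem)).
Qed.
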